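(* Let $\gamma>0$ be a given disturbance attenuation level. Consider the system $x_{k+1}=f_k(x_k,w_k,v_k)$, $y_k=g_k(x_k,v_k)$, $z_k=m_k(x_k,v_k)$ and the filter $\hat x_{k+1}=\hat f_k(\hat x_k)+\hat g_k(y_k)$, $\hat z_k=\hat m_k(\hat x_k)$, with augmented system $\eta_{k+1}=\tilde f_k(\eta_k,w_k,v_k)$, $\tilde z_k=\tilde m_k(\eta_k,v_k)$ as described in the context. Suppose there exist a positive definite radially unbounded Lyapunov function sequence $\{V_k\}_{k\in\mathcal N}$, $V_k:\mathcal R^{n_\eta}\to[0,\infty)$, and a positive radially unbounded function $W:\mathcal R^{n_\eta}\to[0,\infty)$ such that $$E[V_{k+1}(\tilde f_k(\eta,w_k,v))]-V_k(\eta)+\|\tilde m_k(\eta,v)\|^2-\gamma^2\|v\|^2\le0\quad\text{for all }\eta\in\mathcal R^{n_\eta},\ v\in\mathcal R^{n_v},\ k\in\mathcal N,$$ and $$\|\tilde m_k(\eta,0)\|^2\ge W(\eta)\quad\text{for all }\eta\in\mathcal R^{n_\eta},\ k\in\mathcal N.$$ Then the filter is a desired $H_\infty$ filter for the system, i.e. the augmented system is both internally stable and externally stable (with level $\gamma$).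
   Context: $\mathcal N=\{0,1,2,\dots\}$. $\{w_k\}_{k\in\mathcal N}$ is a sequence of independent $\mathcal R^{n_w}$-valued random variables on a complete probability space $(\Omega,\mathcal F,\mathcal P)$, $\mathcal F_0=\{\emptyset,\Omega\}$, $\mathcal F_k=\sigma(w_0,\dots,w_{k-1})$. $l^2_\infty(\Omega,\mathcal F,\{\mathcal F_k\},\mathcal R^{n_v})$ is the space of $\mathcal F_k$-adapted sequences $v=\{v_k\}$ with $\|v\|^2_{l^2_\infty}=E\sum_{k\ge0}\|v_k\|^2<\infty$. System: $x_k\in\mathcal R^n$, $y_k\in\mathcal R^{n_y}$, $z_k\in\mathcal R^{n_z}$, disturbance $v_k\in\mathcal R^{n_v}$; $f_k,g_k,m_k$ are continuous with $f_k(0,0,0)=0$, $g_k(0,0)=0$, $m_k(0,0)=0$ for all $k$. Filter: $\hat x_k\in\mathcal R^{n_{\hat x}}$, $\hat x_0=0$, with (Borel measurable) maps satisfying $\hat f_k(0)=\hat g_k(0)=0$, $\hat m_k(0)=0$. Augmented system: $\eta_k=\begin{bmatrix}x_k\\ \hat x_k\end{bmatrix}\in\mathcal R^{n_\eta}$, $\tilde z_k=z_k-\hat z_k$, and for $\eta=\begin{bmatrix}x\\ \hat x\end{bmatrix}$, $\tilde f_k(\eta,w,v)=\begin{bmatrix}f_k(x,w,v)\\ \hat f_k(\hat x)+\hat g_k(g_k(x,v))\end{bmatrix}$, $\tilde m_k(\eta,v)=m_k(x,v)-\hat m_k(\hat x)$. Positive definite sequence: each $V_k$ is continuous, $V_k(0)=0$,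 and there is a continuous strictly increasing $\mu:[0,\infty)\to[0,\infty)$ with $\mu(0)=0$, $\mu(t)>0$ for $t>0$ such that $V_k(\eta)\ge\mu(\|\eta\|)$ for all $k,\eta$. Radially unbounded sequence: $\liminf_{\|\eta\|\to\infty}\inf_{k\in\mathcal N}V_k(\eta)=\infty$. A positive radially unbounded function $W$: continuous, $W(0)=0$, $W(\eta)>0$ for $\eta\ne0$, $\liminf_{\|\eta\|\to\infty}W(\eta)=\infty$. Internally stable: with $v\equiv0$, the solution $\eta_k^{0,\eta_0,0}$ of $\eta_{k+1}=\tilde f_k(\eta_k,w_k,0)$ starting at time $0$ from deterministic $\eta_0\in\mathcal R^{n_\eta}$ satisfies: for every $\varepsilon>0$, $\lim_{\eta_0\to0}\mathcal P(\sup_{k\ge0}\|\eta_k^{0,\eta_0,0}\|>\varepsilon)=0$; and $\mathcal P(\lim_{k\to\infty}\eta_k^{0,\eta_0,0}=0)=1$ for every $\eta_0$. Externally stable (level $\gamma$): for every nonzero $v\in l^2_\infty(\Omega,\mathcal F,\{\mathcal F_k\},\mathcal R^{n_v})$ and $\eta_0=0$, $\|\tilde z\|^2_{l^2_\infty}\le\gamma^2\|v\|^2_{l^2_\infty}$. *)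

(* Defs.v *)
From HB Require Import structures.
From mathcomp Require Import all_boot all_order all_algebra finmap.
From mathcomp Require Import all_classical all_reals all_analysis.

Set Implicit Arguments.
Unset Strict Implicit.
Unset Printing Implicit Defensive.

Import Order.TTheory GRing.Theory Num.Theory.
Import numFieldNormedType.Exports.

Local Open Scope classical_set_scope.
Local Open Scope ring_scope.

(* The norm on matrices provided by MathComp-Analysis is the sup norm. *)
Definition enorm (R : realType) (n : nat) (x : 'cV[R]_n) : R :=
  Num.sqrt (\sum_(i < n) x i 0 ^+ 2).

(* R^n as a measurable space, with its Borel sigma-algebra. *)
Notation borelV R n := (g_sigma_algebraType (@open 'cV[R]_n)).

Section Probability.
Context {d : measure_display} {Omega : measurableType d} {R : realType}.

Definition independent_seq (P : probability Omega R) (n : nat)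
    (w : nat -> Omega -> 'cV[R]_n) : Prop :=
  forall (J : {fset nat}) (B : nat -> set (borelV R n)),
    (forall k, measurable (B k)) ->
    P (\bigcap_(k in [set` J]) (w k @^-1` B k)) =
    (\prod_(k <- J) P (w k @^-1` B k))%E.

(* F_k = sigma(w_0, ..., w_{k-1}), so that F_0 = {set0, setT}; it is not
   completed by the null sets. *)
Definition noise_filtration (n : nat) (w : nat -> Omega -> 'cV[R]_n) (k : nat) :
    set (set Omega) :=
  g_sigma_preimage (fun i : 'I_k => (w i : Omega -> borelV R n)).

Definition adapted (F : nat -> set (set Omega)) (n : nat)
    (v : nat -> Omega -> 'cV[R]_n) : Prop :=
  forall (k : nat) (B : set (borelV R n)), measurable B -> F k (v k @^-1` B).

Definition l2normsq (P : probability Omega R) (n : nat)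
    (v : nat -> Omega -> 'cV[R]_n) : \bar R :=
  (\int[P]_om \sum_(0 <= k <oo) (enorm (v k om) ^+ 2)%:E)%E.

Definition l2_infty (P : probability Omega R) (F : nat -> set (set Omega))
    (n : nat) (v : nat -> Omega -> 'cV[R]_n) : Prop :=
  adapted F v /\ (l2normsq P v < +oo)%E.

(* Elements of l2_infty are identified when they agree almost surely. *)
Definition l2_zero (P : probability Omega R) (n : nat)
    (v : nat -> Omega -> 'cV[R]_n) : Prop :=
  forall k, {ae P, forall om, v k om = 0}.

End Probability.

Section AugmentedSystem.
Context {R : realType} {nx nh nw nv ny nz : nat}.

(* The augmented state is eta = col_mx x xhat. *)
Definition aug_f (f : nat -> 'cV[R]_nx -> 'cV[R]_nw -> 'cV[R]_nv -> 'cV[R]_nx)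
    (g : nat -> 'cV[R]_nx -> 'cV[R]_nv -> 'cV[R]_ny)
    (fh : nat -> 'cV[R]_nh -> 'cV[R]_nh) (gh : nat -> 'cV[R]_ny -> 'cV[R]_nh)
    (k : nat) (eta : 'cV[R]_(nx + nh)) (w : 'cV[R]_nw) (v : 'cV[R]_nv) :
    'cV[R]_(nx + nh) :=
  col_mx (f k (usubmx eta) w v)
         (fh k (dsubmx eta) + gh k (g k (usubmx eta) v)).

Definition aug_m (m : nat -> 'cV[R]_nx -> 'cV[R]_nv -> 'cV[R]_nz)
    (mh : nat -> 'cV[R]_nh -> 'cV[R]_nz)
    (k : nat) (eta : 'cV[R]_(nx + nh)) (v : 'cV[R]_nv) : 'cV[R]_nz :=
  m k (usubmx eta) v - mh k (dsubmx eta).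

End AugmentedSystem.

Section Lyapunov.
Context {R : realType} {n : nat}.

Definition positive_definite_seq (V : nat -> 'cV[R]_n -> R) : Prop :=
  [/\ forall k, continuous (V k),
      forall k, V k 0 = 0 &
      exists mu : R -> R,
        [/\ {within `[0, +oo[, continuous mu},
            {in `[0, +oo[ &, {homo mu : s t / s < t}},
            mu 0 = 0,
            forall t : R, 0 < t -> 0 < mu t &
            forall k eta, mu (enorm eta) <= V k eta]].

(* The filter of neighbourhoods of infinity of R^n. *)
Definition enorm_infty : set (set 'cV[R]_n) :=
  [set A | exists M : R, forall eta, M < enorm eta -> A eta].

Definition radially_unbounded_seq (V : nat -> 'cV[R]_n -> R) : Prop :=
  limf_einf (fun eta => ereal_inf (range (fun k => (V k eta)%:E))) enorm_infty
  = +oo%E.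

Definition positive_radially_unbounded (W : 'cV[R]_n -> R) : Prop :=
  [/\ continuous W,
      W 0 = 0,
      forall eta, eta != 0 -> 0 < W eta &
      limf_einf (fun eta => (W eta)%:E) enorm_infty = +oo%E].

End Lyapunov.

Section Stability.
Context {d : measure_display} {Omega : measurableType d} {R : realType}.
Context {n nw nv nz : nat}.

Fixpoint trajectory (F : nat -> 'cV[R]_n -> 'cV[R]_nw -> 'cV[R]_nv -> 'cV[R]_n)
    (w : nat -> Omega -> 'cV[R]_nw) (v : nat -> Omega -> 'cV[R]_nv)
    (eta0 : 'cV[R]_n) (k : nat) (om : Omega) : 'cV[R]_n :=
  if k is j.+1 then F j (trajectory F w v eta0 j om) (w j om) (v j om)
  else eta0.

Definition internally_stable (P : probability Omega R)
    (F : nat -> 'cV[R]_n -> 'cV[R]_nw -> 'cV[R]_nv -> 'cV[R]_n)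
    (w : nat -> Omega -> 'cV[R]_nw) : Prop :=
  let sol eta0 := trajectory F w (fun _ _ => 0) eta0 in
  (forall eps : R, 0 < eps ->
     P [set om | (eps%:E <
         ereal_sup (range (fun k => (enorm (sol eta0 k om))%:E)))%E]
       @[eta0 --> (0 : 'cV[R]_n)^'] --> 0%E) /\
  (forall eta0 : 'cV[R]_n,
     P [set om | sol eta0 k om @[k --> \oo] --> (0 : 'cV[R]_n)] = 1%E).

Definition externally_stable (P : probability Omega R)
    (F : nat -> 'cV[R]_n -> 'cV[R]_nw -> 'cV[R]_nv -> 'cV[R]_n)
    (M : nat -> 'cV[R]_n -> 'cV[R]_nv -> 'cV[R]_nz)
    (w : nat -> Omega -> 'cV[R]_nw) (gamma : R) : Prop :=
  forall v : nat -> Omega -> 'cV[R]_nv,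
    l2_infty P (noise_filtration w) v -> ~ l2_zero P v ->
    (l2normsq P (fun k om => M k (trajectory F w v 0 k om) (v k om)) <=
       (gamma ^+ 2)%:E * l2normsq P v)%E.

Definition Hinfty_filter (P : probability Omega R)
    (F : nat -> 'cV[R]_n -> 'cV[R]_nw -> 'cV[R]_nv -> 'cV[R]_n)
    (M : nat -> 'cV[R]_n -> 'cV[R]_nv -> 'cV[R]_nz)
    (w : nat -> Omega -> 'cV[R]_nw) (gamma : R) : Prop :=
  internally_stable P F w /\ externally_stable P F M w gamma.

End Stability.

(* Main.v *)
Require Import Defs.
From HB Require Import structures.
From mathcomp Require Import all_boot all_order all_algebra finmap.
From mathcomp Require Import all_classical all_reals all_analysis.
From mathcomp Require Import measurable_realfun.

(**
  The state eta_k and the disturbance v_k are functions of w_0, ..., w_{k-1},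
  hence independent of w_k.  Freezing (eta_k, v_k) therefore turns the pointwise
  dissipation inequality into
    E[V_{k+1}(eta_{k+1}); A] + E[|z_k|^2; A]
      <= E[V_k(eta_k); A] + gamma^2 E[|v_k|^2; A]   for every A in F_k.
  Summing over k with A = Omega and eta_0 = 0 is external stability.  For v = 0
  the sequence V_k(eta_k) is a nonnegative supermartingale, and its maximal
  inequality bounds P(sup_k |eta_k| > eps) by V_0(eta_0) / mu(eps).  The same
  sum for v = 0 gives E[sum_k W(eta_k)] <= V_0(eta_0), so W(eta_k) tends to 0
  almost surely; as W is bounded below by a positive constant outside every
  ball around 0, eta_k tends to 0 as well.
*)

Set Implicit Arguments.
Unset Strict Implicit.
Unset Printing Implicit Defensive.

Import Order.TTheory GRing.Theory Num.Theory.
Import numFieldNormedType.Exports.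

Local Open Scope classical_set_scope.
Local Open Scope ring_scope.

(** * Second countability and Borel maps *)

Definition countably_based (X : topologicalType) :=
  exists (I : countType) (B : I -> set X), (forall i, open (B i)) /\
    forall x U, nbhs x U -> exists2 i, B i x & B i `<=` U.

Lemma countably_based_prod (X Y : topologicalType) :
  countably_based X -> countably_based Y -> countably_based (X * Y)%type.
Proof.
move=> [I [B [oB nB]]] [J [C [oC nC]]].
exists (I * J)%type, (fun ij => B ij.1 `*` C ij.2); split=> [[i j]|[x y] U].
  rewrite openE => -[x y] /= [Bx Cy].
  exists (B i, C j) => //.
  by split; [exact: open_nbhs_nbhs (conj (oB i) Bx)
            |exact: open_nbhs_nbhs (conj (oC j) Cy)].
move=> [[P Q] /= [/nB[i Bx BP] /nC[j Cy CQ]] PQU].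
by exists (i, j) => // -[x' y'] [/= /BP ? /CQ ?]; exact: PQU.
Qed.

(** The base consists of the balls with a rational centre and radius [1/(r+1)]; density of the
    rationals, used entry by entry, supplies the centres. *)
Lemma countably_based_mx (R : realType) (m n : nat) :
  countably_based 'M[R]_(m, n).
Proof.
exists ('M[rat]_(m, n) * nat)%type,
  (fun qr => ball (map_mx ratr qr.1 : 'M[R]_(m, n)) qr.2.+1%:R^-1).
split=> [qr|x U /nbhs_ballP[e /= e0 xeU]]; first exact: ball_open.
have e20 : 0 < e / 2 by rewrite divr_gt0.
(* This makes [1/(r+1) < e/2], so a ball of that radius containing [x] lies inside the [e]-ball
   around [x]. *)
pose r := Num.truncn (e / 2)^-1.
have r0 : 0 < r.+1%:R^-1 :> R by rewrite invr_gt0.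
have re : r.+1%:R^-1 < e / 2 by rewrite invf_plt ?posrE// truncnS_gt.
have H i j : exists q : rat, ball (x i j) r.+1%:R^-1 (ratr q).
  have ball0 : ball (x i j) r.+1%:R^-1 !=set0 by exists (x i j); exact: ballxx.
  have [z [xz [q _ qE]]] := dense_rat ball0 (ball_open _ _).
  by exists q; rewrite qE.
pose q := \matrix_(i, j) sval (cid (H i j)).
have qx : ball (map_mx ratr q : 'M[R]_(m, n)) r.+1%:R^-1 x.
  split=> // i j; rewrite !mxE; apply: ball_sym; exact: svalP (cid (H i j)).
exists (q, r) => //= y qy; apply: xeU; rewrite /= [e]splitr.
exact: ball_triangle (le_ball (ltW re) (ball_sym qx)) (le_ball (ltW re) qy).
Qed.

(** Measurability is tested on open sets only, so that composition with a continuous map is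
    immediate. *)
Definition borel_fun d (T : measurableType d) (X : topologicalType)
  (x : T -> X) := forall U, open U -> measurable (x @^-1` U).

Section BorelFun.
Context d (T : measurableType d).

Lemma borel_funP (X : ptopologicalType) (x : T -> X) :
  borel_fun x <->
  measurable_fun setT (x : T -> g_sigma_algebraType (@open X)).
Proof.
split=> [bx|mx U oU].
  apply: (@measurability _ _ T (g_sigma_algebraType (@open X)) setT x
    (@open X)) => // _ [U oU <-].
  by rewrite setTI; exact: bx.
by rewrite -[_ @^-1` _]setTI; apply: mx => //; exact: sub_sigma_algebra.
Qed.

Lemma borel_fun_comp (X Y : topologicalType) (h : X -> Y) (x : T -> X) :
  continuous h -> borel_fun x -> borel_fun (h \o x).
Proof. by move=> /continuousP hc bx U /hc /bx. Qed.

(** With countable bases, every open set of the product is a countable union of basic boxes, whose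
    preimages are intersections of two measurable sets. *)
Lemma borel_fun_pair (X Y : topologicalType) (x : T -> X) (y : T -> Y) :
  countably_based X -> countably_based Y ->
  borel_fun x -> borel_fun y -> borel_fun (fun t => (x t, y t)).
Proof.
move=> [I [B [oB nB]]] [J [C [oC nC]]] bx yb U oU.
(* Boxes not contained in [U] contribute the empty set, so the union runs over the whole countable
   type [I * J]. *)
have -> : (fun t => (x t, y t)) @^-1` U =
  \bigcup_(ij : I * J) if pselect (B ij.1 `*` C ij.2 `<=` U) then
     (x @^-1` B ij.1) `&` (y @^-1` C ij.2) else set0.
  apply/seteqP; split=> [t /= Ut|t [[i j] _]]; last first.
    by case: pselect => //= BCU [? ?]; exact: BCU.
  have /= [[P Q] /= [/nB[i Bx BP] /nC[j Cy CQ]] PQU] :=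
    open_nbhs_nbhs (conj oU Ut).
  exists (i, j) => //; case: pselect => // -[] [x' y'] [/= /BP ? /CQ ?].
  exact: PQU.
apply: countable_bigcupT_measurable => [|[i j]]; first exact: countableP.
case: pselect => [BCU|_] //=.
by apply: measurableI; [exact: bx|exact: yb].
Qed.

Lemma borel_fun_real (R : realType) (x : T -> R) :
  borel_fun x -> measurable_fun setT x.
Proof.
move=> bx; apply: (measurability (@RGenOpens.G R)).
  exact: RGenOpens.measurableE.
move=> _ [_ [a [b ->]] <-]; rewrite setTI; apply: bx; exact: interval_open.
Qed.

End BorelFun.

(* The sample space with the sigma-algebra F_k: its measurable sets are, by
   definition, the members of [noise_filtration w k]. *)
Notation noise_type w k := (g_sigma_algebraType
  (\big[setU/set0]_(i < k)
     preimage_set_system setT (w i : _ -> borelV _ _) measurable)).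

(** * The noise filtration and its independence from the current noise *)

Section Noise.
Context d (Omega : measurableType d) (R : realType) (P : probability Omega R).
Variables (nw : nat) (w : nat -> Omega -> 'cV[R]_nw).
Hypothesis w_meas :
  forall k, measurable_fun [set: Omega] (w k : Omega -> borelV R nw).
Hypothesis w_indep : independent_seq P w.

Lemma noise_filtrationE k (A : set Omega) :
  noise_filtration w k A = measurable (A : set (noise_type w k)).
Proof. by []. Qed.

Lemma noise_gen k (A : set Omega) :
  (\big[setU/set0]_(i < k)
     preimage_set_system setT (w i : _ -> borelV _ _) measurable) A <->
  exists2 i, (i < k)%N &
    preimage_set_system setT (w i : _ -> borelV _ _) measurable A.
Proof.
rewrite -(bigcup_mkord k
  (fun i => preimage_set_system setT (w i : _ -> borelV _ _) measurable)).
by split=> [[i /= ik wA]|[i ik wA]]; exists i.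
Qed.

Lemma noise_filtration_sub k (A : set Omega) :
  noise_filtration w k A -> measurable A.
Proof.
apply: smallest_sub; first exact: sigma_algebra_measurable.
by move=> _ /noise_gen[i _ [B mB <-]]; exact: w_meas.
Qed.

Lemma noise_filtration_le k l (A : set Omega) : (k <= l)%N ->
  noise_filtration w k A -> noise_filtration w l A.
Proof.
move=> kl; apply: sub_sigma_algebra2 => {}A /noise_gen[i ik wA].
by apply/noise_gen; exists i => //; exact: leq_trans kl.
Qed.

Lemma noise_measurable k l : (k < l)%N ->
  measurable_fun [set: noise_type w l] (w k : noise_type w l -> borelV R nw).
Proof.
move=> kl _ B mB; apply: sub_gen_smallest; apply: (noise_gen l _).2.
by exists k => //; exists B.
Qed.

(** For fixed [B], both sides are finite measures in [A]; they agree on a pi-system generating F_k,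
    hence on F_k. *)
Lemma noise_indep k (A : set Omega) (B : set (borelV R nw)) :
  noise_filtration w k A -> measurable B ->
  P (A `&` w k @^-1` B) = (P A * P (w k @^-1` B))%E.
Proof.
move=> FA mB.
have mwB : measurable (w k @^-1` B).
  by rewrite -[_ @^-1` _]setTI; exact: w_meas.
(* The pi-system: cylinders in w_0, ..., w_{k-1}. *)
pose G : set (set Omega) := [set A | exists2 C : nat -> set (borelV R nw),
  forall i, measurable (C i) & A = \bigcap_(i in `I_k) (w i @^-1` C i)].
have Gm : G `<=` measurable.
  move=> _ [C mC ->]; apply: bigcap_measurableType => // i _.
  by rewrite -[_ @^-1` _]setTI; exact: w_meas.
have GT : G setT.
  by exists (fun=> setT) => //; rewrite bigcapT// => i _; rewrite preimage_setT.
have GI : setI_closed G.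
  move=> _ _ [C mC ->] [D mD ->]; exists (fun i => C i `&` D i).
    by move=> i; exact: measurableI.
  by rewrite -bigcapI; apply: eq_bigcapr => i _; rewrite preimage_setI.
have P_bigcap (j : nat) (C : nat -> set (borelV R nw)) :
    (forall i, measurable (C i)) ->
    P (\bigcap_(i in `I_j) (w i @^-1` C i)) =
    (\prod_(i < j) P (w i @^-1` C i))%E.
  move=> mC; have := w_indep [fset i in iota 0 j]%fset mC.
  have -> : [set` [fset i in iota 0 j]%fset] = `I_j.
    by apply/seteqP; split=> i /=; rewrite !inE/= mem_iota add0n.
  move=> ->; rewrite (perm_big (iota 0 j)) /=.
    by rewrite -[in iota _ _](subn0 j) -/(index_iota 0 j) big_mkord.
  apply: uniq_perm => [||i]; [exact: fset_uniq|exact: iota_uniq|].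
  by rewrite !inE.
pose Q : {measure set Omega -> \bar R} := mrestr P mwB.
pose c := fine (P (w k @^-1` B)).
have c0 : 0 <= c by exact: fine_ge0.
pose Q' : {measure set Omega -> \bar R} := mscale (NngNum c0) P.
have cE : (c%:E = P (w k @^-1` B))%E by rewrite fineK// fin_num_measure.
have Q'E E : Q' E = (P E * P (w k @^-1` B))%E by rewrite muleC -cE.
suff : Q A = Q' A by rewrite Q'E.
apply: (@g_sigma_algebra_measure_unique _ _ _ G _ (fun=> setT)) => //.
- by rewrite bigcup_const//; exists 0%N.
- move=> _ [C mC ->]; rewrite Q'E /Q/= /mrestr.
  (* Imposing [B] at coordinate [k] turns the intersection into a cylinder in w_0, ..., w_k, to
     which independence applies. *)
  pose D i := if (i == k) then B else C i.
  have mD i : measurable (D i) by rewrite /D; case: ifP.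
  have Dk : D k = B by rewrite /D eqxx.
  have := P_bigcap k.+1 D mD.
  rewrite big_ord_recr /= Dk (_ : \big[_/_]_(i < k) _ =
    P (\bigcap_(i in `I_k) (w i @^-1` C i))).
    move=> <-; congr (P _).
    rewrite IIS bigcap_setU bigcap_set1 Dk; congr (_ `&` _).
    by apply: eq_bigcapr => i /= ik; rewrite /D ltn_eqF.
  rewrite P_bigcap//; apply: eq_bigr => i _; rewrite /D ltn_eqF//.
- by move=> _; rewrite /Q/= /mrestr setTI; rewrite -cE ltry.
- move: FA; apply: sub_sigma_algebra2 => _ /noise_gen[i ik [C mC <-]].
  (* A generator of F_k is a cylinder that constrains the single coordinate [i]. *)
  exists (fun j => if j == i then C else setT); first by move=> j; case: ifP.
  apply/seteqP; split=> [t [_ Ct] j jk|t Ct] /=.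
    by case: eqP => // ->.
  by split=> //; have := Ct i ik; rewrite /= eqxx.
Qed.

End Noise.

(** * Freezing one of two independent variables *)

Section Freezing.
Local Open Scope ereal_scope.
Context d (Omega : measurableType d) (R : realType) (P : probability Omega R).
Context d1 d2 (T1 : measurableType d1) (T2 : measurableType d2).
Variables (X : Omega -> T1) (Y : Omega -> T2).
Hypotheses (mX : measurable_fun setT X) (mY : measurable_fun setT Y).
Hypothesis XY_indep : forall A B, measurable A -> measurable B ->
  P (X @^-1` A `&` Y @^-1` B) = P (X @^-1` A) * P (Y @^-1` B).
Variable H : T1 * T2 -> \bar R.
Hypotheses (mH : measurable_fun setT H) (H0 : forall z, 0 <= H z).

Let X' : {mfun Omega >-> T1} := HB.pack X (isMeasurableFun.Build _ _ _ _ X mX).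
Let Y' : {mfun Omega >-> T2} := HB.pack Y (isMeasurableFun.Build _ _ _ _ Y mY).

Let inner x : \int[distribution P Y']_y H (x, y) = \int[P]_om H (x, Y om).
Proof.
rewrite ge0_integral_distribution//.
exact: measurableT_comp mH (pair1_measurable x).
Qed.

(** The integral is the Tonelli section function of [H] for the law of [Y]. *)
Lemma measurable_freezing :
  measurable_fun setT (fun x => \int[P]_om H (x, Y om)).
Proof.
have := @measurable_fun_fubini_tonelli_F _ _ _ _ _ (distribution P Y') H mH H0.
by apply: eq_measurable_fun => x _; rewrite /fubini_F inner.
Qed.

(* The joint law of [X] and [Y] is the product of their laws. *)
Lemma integral_freezing :
  \int[P]_om H (X om, Y om) = \int[P]_om \int[P]_om' H (X om, Y om').
Proof.
have mXY : measurable_fun setT (fun om => (X om, Y om)).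
  exact: measurable_fun_pair.
pose XY : {mfun Omega >-> (T1 * T2)%type} :=
  HB.pack (fun om => (X om, Y om)) (isMeasurableFun.Build _ _ _ _ _ mXY).
transitivity (\int[distribution P XY]_z H z).
  by rewrite ge0_integral_distribution.
transitivity (\int[distribution P X' \x distribution P Y']_z H z).
  apply: eq_measure_integral => A mA _; apply/esym.
  apply: product_measure_unique => //.
rewrite fubini_tonelli1//.
rewrite ge0_integral_distribution/=; last 2 first.
- exact: measurable_fun_fubini_tonelli_F.
- by move=> x; apply: integral_ge0.
by apply: eq_integral => om _ /=; rewrite /fubini_F inner.
Qed.

End Freezing.

(** * The maximal inequality for nonnegative supermartingales *)

Section Maximal.
Context d (Omega : measurableType d) (R : realType) (P : probability Omega R).
Local Open Scope ereal_scope.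

(** Markov's inequality on the part of [D] where [f] exceeds [a], keeping the integral over the rest
    so that the bound can be iterated in time. *)
Lemma markov_split (f : Omega -> R) (D : set Omega) (a : R) :
  measurable D -> measurable_fun setT f -> (forall om, (0 <= f om)%R) ->
  a%:E * P (D `&` [set om | (a < f om)%R]) +
    \int[P]_(om in D `\` [set om | (a < f om)%R]) (f om)%:E <=
  \int[P]_(om in D) (f om)%:E.
Proof.
move=> mD mf f0; set B := [set om | _].
have mB : measurable B.
  by rewrite -[B]setTI; exact: measurable_fun_ltr.
have mDB : measurable (D `&` B) by exact: measurableI.
have mDNB : measurable (D `\` B) by exact: measurableD.
have mfE E : measurable_fun E (EFin \o f).
  by apply: measurable_funTS; exact/measurable_EFinP.
rewrite -{3}(setUIDK D B) ge0_integral_setU//=; last 2 first.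
- by move=> om _; rewrite lee_fin.
- by apply/disj_set2P; rewrite setDE setIACA setICr setI0.
apply: leeD2r; rewrite -integral_cst//.
have [a0|a0] := leP 0%R a.
  by apply: ge0_le_integral => //= om [_]; rewrite /B/= lee_fin => /ltW.
apply: (@le_trans _ _ 0); last by apply: integral_ge0 => om _; rewrite lee_fin.
by rewrite integral_cst// mule_le0_ge0// lee_fin ltW.
Qed.

(* By induction on k, with C k the event that some X_j, j < k, exceeds [a]:
   a * P(C k) + E[X_k; ~ C k] <= E[X_0]. *)
Lemma supermartingale_maximal_inequality (X : nat -> Omega -> R) (a : R) :
  (forall k, measurable_fun setT (X k)) -> (forall k om, (0 <= X k om)%R) ->
  let B k := [set om | (a < X k om)%R] in
  (forall k, \int[P]_(om in ~` \bigcup_(j in `I_k.+1) B j) (X k.+1 om)%:E <=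
             \int[P]_(om in ~` \bigcup_(j in `I_k.+1) B j) (X k om)%:E) ->
  (0 <= a)%R ->
  a%:E * P (\bigcup_k B k) <= \int[P]_om (X 0%N om)%:E.
Proof.
move=> mX X0 B superX a0; pose C k := \bigcup_(j in `I_k) B j.
have mB k : measurable (B k).
  by rewrite -[B k]setTI; exact: measurable_fun_ltr.
have mC k : measurable (C k) by exact: bigcup_measurable.
have mCC k : measurable (~` C k) by exact: measurableC.
have CS k : C k.+1 = C k `|` (~` C k `&` B k).
  by rewrite /C IIS bigcup_setU bigcup_set1 setUIr setUCr setTI.
have NCS k : ~` C k.+1 = ~` C k `\` B k.
  by rewrite /C IIS bigcup_setU bigcup_set1 setCU setDE.
have maxC k : a%:E * P (C k) + \int[P]_(om in ~` C k) (X k om)%:E <=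
    \int[P]_om (X 0%N om)%:E.
  elim: k => [|k IHk].
    by rewrite /C II0 bigcup_set0 measure0 mule0 add0e setC0.
  (* Off [C k.+1], [X k.+1] is first replaced by [X k]; [markov_split] on the complement of [C k]
     then pays for the newly added event. *)
  apply: le_trans IHk; apply: le_trans (leeD2l _ (superX k)) _.
  rewrite -/(C k.+1) NCS CS measureU//; last 2 first.
  - exact: measurableI.
  - by rewrite setIA setICr set0I.
  rewrite ge0_muleDr// -addeA leeD2l//.
  exact: markov_split.
have PC k : a%:E * P (C k) <= \int[P]_om (X 0%N om)%:E.
  apply: le_trans (maxC k); rewrite leeDl//.
  by apply: integral_ge0 => om _; rewrite lee_fin.
have CB : \bigcup_k C k = \bigcup_k B k.
  apply/seteqP; split=> [om [k _ [j _ Bj]]|om [k _ Bk]]; first by exists j.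
  by exists k.+1 => //; exists k => /=.
(* The events [C k] increase, so continuity of [P] from below carries the bound to their union. *)
have PCcvg : P (C k) @[k --> \oo] --> P (\bigcup_k B k).
  rewrite -CB; apply: nondecreasing_cvg_mu => //.
    exact: bigcup_measurable.
  move=> j k jk; apply/subsetPset => om [i ij Bi]; exists i => //=.
  exact: leq_trans jk.
have aPC : a%:E * P (C k) @[k --> \oo] --> a%:E * P (\bigcup_k B k).
  by apply: cvgeZl.
rewrite -(cvg_lim _ aPC)//; apply: lime_le; last exact: nearW.
by apply/cvg_ex; eexists; exact: aPC.
Qed.

End Maximal.

(** * The dissipation inequality along trajectories *)

Section Dissipation.
Context d (Omega : measurableType d) (R : realType) (P : probability Omega R).
Variables (n nw nv : nat) (w : nat -> Omega -> 'cV[R]_nw).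
Hypothesis w_meas :
  forall k, measurable_fun [set: Omega] (w k : Omega -> borelV R nw).
Hypothesis w_indep : independent_seq P w.
Variable F : nat -> 'cV[R]_n -> 'cV[R]_nw -> 'cV[R]_nv -> 'cV[R]_n.
Hypothesis F_meas : forall k,
  measurable_fun [set: (borelV R n * borelV R nw * borelV R nv)%type]
    (fun p => F k p.1.1 p.1.2 p.2 : borelV R n).
Variables (V : nat -> 'cV[R]_n -> R) (M : nat -> 'cV[R]_n -> 'cV[R]_nv -> R).
Variable S : 'cV[R]_nv -> R.
Hypotheses (V_ge0 : forall k x, 0 <= V k x).
Hypotheses (M_ge0 : forall k x u, 0 <= M k x u) (S_ge0 : forall u, 0 <= S u).
Hypothesis V_meas : forall k, measurable_fun [set: borelV R n] (V k).
Hypothesis M_meas : forall k,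
  measurable_fun [set: (borelV R n * borelV R nv)%type] (fun p => M k p.1 p.2).
Hypothesis S_meas : measurable_fun [set: borelV R nv] S.
Hypothesis dissipation : forall k x u,
  (\int[P]_om (V k.+1 (F k x (w k om) u))%:E + (M k x u)%:E <=
   (V k x)%:E + (S u)%:E)%E.
Variables (v : nat -> Omega -> 'cV[R]_nv) (x0 : 'cV[R]_n).
Hypothesis v_adapted : adapted (noise_filtration w) v.

Local Notation x := (trajectory F w v x0).

Lemma noise_type_measurable_fun k d' (T : measurableType d') (h : Omega -> T) :
  measurable_fun [set: noise_type w k] (h : noise_type w k -> T) ->
  measurable_fun [set: Omega] h.
Proof.
by move=> mh _ B mB; apply: (noise_filtration_sub w_meas (k := k)); exact: mh.
Qed.

Lemma noise_type_le k l d' (T : measurableType d') (h : Omega -> T) :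
  (k <= l)%N ->
  measurable_fun [set: noise_type w k] (h : noise_type w k -> T) ->
  measurable_fun [set: noise_type w l] (h : noise_type w l -> T).
Proof.
by move=> kl mh _ B mB; apply: (noise_filtration_le kl); exact: mh.
Qed.

Lemma adapted_measurable k :
  measurable_fun [set: noise_type w k] (v k : noise_type w k -> borelV R nv).
Proof. by move=> _ B mB; rewrite setTI; exact: v_adapted. Qed.

(** Step [k] brings in [w k], which is measurable only from index [k.+1] on; this matches the shift
    from [x k] to [x k.+1]. *)
Lemma trajectory_measurable k :
  measurable_fun [set: noise_type w k] (x k : noise_type w k -> borelV R n).
Proof.
elim: k => [|k IHk]; first exact: measurable_cst.
have mxwv := measurable_fun_pair (measurable_fun_pair
  (noise_type_le (leqnSn k) IHk) (noise_measurable (ltnSn k)))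
  (noise_type_le (leqnSn k) (@adapted_measurable k)).
exact: measurableT_comp (F_meas k) mxwv.
Qed.

Lemma V_trajectory_measurable k :
  measurable_fun [set: noise_type w k]
    (fun om : noise_type w k => V k (x k om)).
Proof. exact: measurableT_comp (V_meas k) (@trajectory_measurable k). Qed.

Lemma M_trajectory_measurable k :
  measurable_fun [set: Omega] (fun om => M k (x k om) (v k om)).
Proof.
apply: (@noise_type_measurable_fun k).
exact: measurableT_comp (M_meas k)
  (measurable_fun_pair (@trajectory_measurable k) (@adapted_measurable k)).
Qed.

Lemma S_measurable k : measurable_fun [set: Omega] (fun om => S (v k om)).
Proof.
apply: (@noise_type_measurable_fun k).
exact: measurableT_comp S_meas (@adapted_measurable k).
Qed.

(** Letting [A] range over F_k expresses the inequality conditionally on F_k without conditional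
    expectations. *)
Lemma one_step_dissipation k (A : set Omega) : noise_filtration w k A ->
  (\int[P]_(om in A) (V k.+1 (x k.+1 om))%:E +
   \int[P]_(om in A) (M k (x k om) (v k om))%:E <=
   \int[P]_(om in A) (V k (x k om))%:E + \int[P]_(om in A) (S (v k om))%:E)%E.
Proof.
move=> FA; have mA := noise_filtration_sub w_meas FA.
pose H (z : noise_type w k * borelV R nw) : \bar R :=
  (V k.+1 (F k (x k z.1) z.2 (v k z.1)))%:E.
have H0 z : (0 <= H z)%E by rewrite lee_fin.
have mH : measurable_fun setT H.
  apply/measurable_EFinP; apply: measurableT_comp (V_meas k.+1) _.
  have mfst := @measurable_fst _ _ (noise_type w k) (borelV R nw).
  exact: measurableT_comp (F_meas k) (measurable_fun_pair (measurable_fun_pair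
    (measurableT_comp (@trajectory_measurable k) mfst) measurable_snd)
    (measurableT_comp (@adapted_measurable k) mfst)).
pose HA (z : noise_type w k * borelV R nw) : \bar R := (H z * (\1_A z.1)%:E)%E.
have HA0 z : (0 <= HA z)%E by rewrite mule_ge0// lee_fin.
have mHA : measurable_fun setT HA.
  apply: emeasurable_funM => //; apply/measurable_EFinP.
  have mI : measurable_fun setT (\1_A : noise_type w k -> R).
    exact: measurable_indic.
  exact: measurableT_comp mI measurable_fst.
have mid : measurable_fun [set: Omega] (id : Omega -> noise_type w k).
  by move=> _ B FB; rewrite setTI; exact: noise_filtration_sub FB.
have indep (B : set (noise_type w k)) (C : set (borelV R nw)) :
    measurable B -> measurable C ->
    P (id @^-1` B `&` w k @^-1` C) = (P (id @^-1` B) * P (w k @^-1` C))%E.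
  exact: noise_indep.
(* A version of the conditional expectation of [V k.+1 (x k.+1)] given F_k. *)
pose h om := (\int[P]_om' H (om, w k om'))%E.
have mh : measurable_fun [set: Omega] h.
  apply: (@noise_type_measurable_fun k).
  exact: (measurable_freezing P (w_meas k) mH H0).
have h0 om : (0 <= h om)%E by apply: integral_ge0 => om' _; exact: H0.
have -> : (\int[P]_(om in A) (V k.+1 (x k.+1 om))%:E =
    \int[P]_(om in A) h om)%E.
  rewrite integral_mkcond epatch_indic.
  rewrite [LHS](integral_freezing mid (w_meas k) indep mHA HA0).
  rewrite [RHS]integral_mkcond epatch_indic; apply: eq_integral => om _ /=.
  rewrite /HA/= ge0_integralZr//.
  by apply: measurableT_comp mH _; exact: measurable_fun_pair.
have mM : measurable_fun A (fun om => (M k (x k om) (v k om))%:E).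
  by apply/measurable_EFinP/measurable_funTS; exact: M_trajectory_measurable.
have mS : measurable_fun A (fun om => (S (v k om))%:E).
  by apply/measurable_EFinP/measurable_funTS; exact: S_measurable.
have mV : measurable_fun A (fun om => (V k (x k om))%:E).
  apply/measurable_EFinP/measurable_funTS.
  exact: noise_type_measurable_fun (@V_trajectory_measurable k).
have mhA : measurable_fun A h by exact: measurable_funTS.
rewrite -!ge0_integralD//=; try by move=> om _; rewrite lee_fin.
apply: ge0_le_integral => //=.
- by move=> om _; rewrite adde_ge0// lee_fin.
- exact: emeasurable_funD.
- exact: emeasurable_funD.
- by move=> om _; exact: (dissipation k (x k om) (v k om)).
Qed.

(** Telescoping by induction; the term in [V N] stays on the left, so no possibly infinite integrals
    are subtracted. *)
Lemma dissipation_sum N :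
  (\int[P]_om (V N (x N om))%:E +
   \sum_(0 <= k < N) \int[P]_om (M k (x k om) (v k om))%:E <=
   (V 0%N x0)%:E + \sum_(0 <= k < N) \int[P]_om (S (v k om))%:E)%E.
Proof.
elim: N => [|N IHN].
  rewrite !big_geq// !adde0 (_ : (fun=> _) = cst (V 0%N x0)%:E)//.
  by rewrite integral_cst//= probability_setT mule1.
have FT : noise_filtration w N [set: Omega].
  by rewrite noise_filtrationE; exact: measurableT.
rewrite !big_nat_recr//=.
rewrite (addeC (\sum_(0 <= k < N) _)%E) addeA.
apply: (le_trans (leeD2r _ (one_step_dissipation FT))).
rewrite addeAC [leRHS]addeA.
exact: leeD2r.
Qed.

(** The nonnegative term in [V N] is dropped from the partial sums, and integrals are exchanged with
    series of nonnegative terms. *)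
Lemma dissipation_series :
  (\int[P]_om \sum_(0 <= k <oo) (M k (x k om) (v k om))%:E <=
   (V 0%N x0)%:E + \int[P]_om \sum_(0 <= k <oo) (S (v k om))%:E)%E.
Proof.
have mM k : measurable_fun setT (fun om => (M k (x k om) (v k om))%:E).
  by apply/measurable_EFinP; exact: M_trajectory_measurable.
have mS k : measurable_fun setT (fun om => (S (v k om))%:E).
  by apply/measurable_EFinP; exact: S_measurable.
have iM0 k : (0 <= \int[P]_om (M k (x k om) (v k om))%:E)%E.
  by apply: integral_ge0 => om _; rewrite lee_fin.
have iS0 k : (0 <= \int[P]_om (S (v k om))%:E)%E.
  by apply: integral_ge0 => om _; rewrite lee_fin.
rewrite !integral_nneseries//; try by move=> k om _; rewrite lee_fin.
apply: lime_le; first by apply: is_cvg_nneseries => k _ _; exact: iM0.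
apply: nearW => N; apply: (@le_trans _ _ ((V 0%N x0)%:E +
    \sum_(0 <= k < N) \int[P]_om (S (v k om))%:E)%E).
  apply: le_trans (dissipation_sum N); rewrite leeDr//.
  by apply: integral_ge0 => om _; rewrite lee_fin.
by apply: leeD2l; apply: nneseries_lim_ge => k _ _; exact: iS0.
Qed.

(** Without supply, dropping the nonnegative [M] term from [one_step_dissipation] leaves the
    supermartingale inequality. *)
Lemma V_maximal_inequality (a : R) :
  (forall k om, S (v k om) = 0) -> 0 <= a ->
  (a%:E * P (\bigcup_k [set om | (a < V k (x k om))%R]) <= (V 0%N x0)%:E)%E.
Proof.
move=> Sv0 a0.
have mV k : measurable_fun [set: Omega] (fun om => V k (x k om)).
  exact: noise_type_measurable_fun (@V_trajectory_measurable k).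
have <- : (\int[P]_om (V 0%N (x 0%N om))%:E = (V 0%N x0)%:E)%E.
  rewrite (integral_cst P measurableT (V 0%N x0)%:E)//=.
  by rewrite probability_setT mule1.
apply: (supermartingale_maximal_inequality
  (X := fun k om => V k (x k om))) => // k.
set A := (~` _).
(* [A] constrains only [x j] with [j <= k], each of them F_k-measurable. *)
have FA : noise_filtration w k A.
  rewrite noise_filtrationE; apply: measurableC.
  apply: bigcup_measurable => j /= jk.
  rewrite -[X in measurable X](@setTI (noise_type w k)).
  apply: measurable_fun_ltr => //.
  exact: noise_type_le (@V_trajectory_measurable j).
have := one_step_dissipation FA.
under [X in (_ <= _ + X)%E]eq_integral do rewrite Sv0.
rewrite integral0 adde0; apply: le_trans; rewrite leeDl//.
by apply: integral_ge0 => om _; rewrite lee_fin.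
Qed.

End Dissipation.

(** * The Euclidean norm, continuity of block operations and compactness *)

Section Norms.
Variable R : realType.

Lemma enorm_ge0 n (x : 'cV[R]_n) : 0 <= enorm x.
Proof. exact: sqrtr_ge0. Qed.

Lemma enorm0 n : enorm (0 : 'cV[R]_n) = 0.
Proof.
rewrite /enorm big1 ?sqrtr0// => i _; rewrite mxE expr0n//.
Qed.

Lemma ler_coord_enorm n (x : 'cV[R]_n) i : `|x i 0| <= enorm x.
Proof.
rewrite -sqrtr_sqr ler_wsqrtr// (bigD1 i)//= lerDl.
by apply: sumr_ge0 => j _; exact: sqr_ge0.
Qed.

Lemma continuous_enorm n : continuous (@enorm R n).
Proof.
move=> x; apply: (continuous_comp (f := fun x : 'cV[R]_n => \sum_i x i 0 ^+ 2)).
  apply: cvg_big => [y||i _]; [exact: add_continuous|exact: nbhs_filter|].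
  exact: (@continuous_comp _ _ _ (fun x : 'cV[R]_n => x i 0)
    (fun y : R => y ^+ 2) x (@coord_continuous _ _ _ i 0 x)
    (@exprn_continuous R 2 _)).
exact: sqrt_continuous.
Qed.

Lemma continuous_mx (X : topologicalType) m n (h : X -> 'M[R]_(m, n)) :
  (forall i j, continuous (fun x => h x i j)) -> continuous h.
Proof.
move=> hc x U [Q hQ QU].
have : \forall y \near x, forall ij, Q ij.1 ij.2 (h y ij.1 ij.2).
  by apply: filter_forall => -[i j]; apply: (hc i j x); exact: hQ.
by apply: filterS => y Qy; apply: QU => i j; exact: Qy (i, j).
Qed.

Lemma continuous_trmx m n : continuous (@trmx R m n).
Proof.
apply: continuous_mx => i j; under eq_fun do rewrite mxE.
exact: coord_continuous.
Qed.

Lemma continuous_usubmx m1 m2 n : continuous (@usubmx R m1 m2 n).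
Proof.
apply: continuous_mx => i j; under eq_fun do rewrite mxE.
exact: coord_continuous.
Qed.

Lemma continuous_dsubmx m1 m2 n : continuous (@dsubmx R m1 m2 n).
Proof.
apply: continuous_mx => i j; under eq_fun do rewrite mxE.
exact: coord_continuous.
Qed.

Lemma continuous_col_mx m1 m2 n :
  continuous (fun p : 'M[R]_(m1, n) * 'M[R]_(m2, n) => col_mx p.1 p.2).
Proof.
apply: continuous_mx => i j; under eq_fun do rewrite mxE.
case: (fintype.split i) => k x.
  exact: (@continuous_comp _ _ _ fst (fun M : 'M[R]_(m1, n) => M k j) x
    cvg_fst (@coord_continuous _ _ _ k j x.1)).
exact: (@continuous_comp _ _ _ snd (fun M : 'M[R]_(m2, n) => M k j) x
  cvg_snd (@coord_continuous _ _ _ k j x.2)).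
Qed.

(** Transfers smallness in the Euclidean norm to the sup norm, which governs convergence of
    matrices. *)
Lemma ler_norm_enorm n (x : 'cV[R]_n) : `|x| <= enorm x.
Proof.
rewrite [leLHS]/Num.Def.normr /= mx_normrE; apply/bigmax_leP.
by split=> [|[i j] _] /=; [exact: enorm_ge0|rewrite ord1 ler_coord_enorm].
Qed.

(** Heine-Borel for row vectors, carried to columns by the continuous transposition. *)
Lemma enorm_bounded_closed_compact n (A : set 'cV[R]_n) (r : R) :
  (forall x, A x -> enorm x <= r) -> closed A -> compact A.
Proof.
move=> Ar Acl.
have -> : A = trmx @` (trmx @^-1` A : set 'rV[R]_n).
  apply/seteqP; split=> [x Ax|_ [x Ax <-] //].
  by exists x^T; rewrite /= trmxK.
apply: continuous_compact.
  by apply: continuous_subspaceT; exact: continuous_trmx.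
apply: bounded_closed_compact.
  exists r; split; first exact: num_real.
  move=> s rs x /Ar xr.
  rewrite /= (le_trans _ (ltW rs))// (le_trans _ xr)//.
  rewrite [leLHS]/Num.Def.normr /= mx_normrE; apply/bigmax_leP.
  split=> [|[i j] _] /=; first exact: enorm_ge0.
  by rewrite ord1; have := ler_coord_enorm x^T j; rewrite mxE.
by apply: closed_comp => // x _; exact: continuous_trmx.
Qed.

(** Beyond some radius [r] radial unboundedness gives [1 <= W x]; on the compact shell between [e]
    and [r], [W] attains a positive minimum. *)
Lemma positive_radially_unbounded_lb n (W : 'cV[R]_n -> R) (e : R) :
  positive_radially_unbounded W -> 0 < e ->
  exists2 a : R, 0 < a & forall x, e <= enorm x -> a <= W x.
Proof.
move=> [Wc W0 Wpos Woo] e0.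
have [r Wr] : exists r : R, forall x, r < enorm x -> 1 <= W x.
  have : (1%:E < limf_einf (fun x => (W x)%:E) enorm_infty)%E.
    by rewrite Woo ltry.
  rewrite limf_einfE => /ereal_sup_gt[_ [A [r rA] <-] A1].
  exists r => x /rA Ax; rewrite -lee_fin (le_trans (ltW A1))//.
  by apply: ereal_inf_lbound; exists x.
pose K := [set x : 'cV[R]_n | e <= enorm x <= r].
have Kc : compact K.
  apply: (@enorm_bounded_closed_compact _ _ r) => [x /andP[]//|].
  rewrite (_ : K = @enorm R n @^-1` `[e, r]); last first.
    by apply/seteqP; split=> x /=; rewrite in_itv.
  apply: closed_comp; last exact: itv_closed.
  by move=> x _; exact: continuous_enorm.
(* If the shell is empty, [e <= enorm x] already forces [r < enorm x]. *)
have [K0|/set0P K0] := eqVneq K set0.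
  exists 1 => // x ex; apply: Wr; rewrite ltNge; apply/negP => xr.
  by have : K x by [rewrite /K/= ex xr]; rewrite K0.
have [c cK Wmin] := compact_EVT_min K0 Kc (continuous_subspaceT Wc).
have Wc0 : 0 < W c.
  apply: Wpos; apply/eqP => c0; move: cK; rewrite inE /K/= c0 enorm0.
  by rewrite leNgt e0.
exists (Num.min 1 (W c)) => [|x ex]; first by rewrite lt_min ltr01.
have [xr|rx] := leP (enorm x) r.
  by rewrite ge_min Wmin ?orbT// inE /K/= ex xr.
by rewrite ge_min Wr.
Qed.

End Norms.

Lemma continuous_borel_measurable (R : realType) n (h : 'cV[R]_n -> R) :
  continuous h -> measurable_fun [set: borelV R n] h.
Proof.
move=> hc; apply: borel_fun_real.
have bid : borel_fun (id : borelV R n -> 'cV[R]_n).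
  by apply/borel_funP; exact: measurable_id.
exact: borel_fun_comp hc bid.
Qed.

(** * Internal stability *)

Section InternalStability.
Context d (Omega : measurableType d) (R : realType) (P : probability Omega R).
Variables (n nw nv : nat) (w : nat -> Omega -> 'cV[R]_nw).
Hypothesis w_meas :
  forall k, measurable_fun [set: Omega] (w k : Omega -> borelV R nw).
Hypothesis w_indep : independent_seq P w.
Variable F : nat -> 'cV[R]_n -> 'cV[R]_nw -> 'cV[R]_nv -> 'cV[R]_n.
Hypothesis F_meas : forall k,
  measurable_fun [set: (borelV R n * borelV R nw * borelV R nv)%type]
    (fun p => F k p.1.1 p.1.2 p.2 : borelV R n).
Variables (V : nat -> 'cV[R]_n -> R) (M : nat -> 'cV[R]_n -> 'cV[R]_nv -> R).
Variable S : 'cV[R]_nv -> R.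
Hypotheses (V_ge0 : forall k x, 0 <= V k x).
Hypotheses (M_ge0 : forall k x u, 0 <= M k x u) (S_ge0 : forall u, 0 <= S u).
Hypothesis V_posdef : positive_definite_seq V.
Hypothesis M_meas : forall k,
  measurable_fun [set: (borelV R n * borelV R nv)%type] (fun p => M k p.1 p.2).
Hypothesis S_meas : measurable_fun [set: borelV R nv] S.
Hypothesis S0 : S 0 = 0.
Hypothesis dissipation : forall k x u,
  (\int[P]_om (V k.+1 (F k x (w k om) u))%:E + (M k x u)%:E <=
   (V k x)%:E + (S u)%:E)%E.
Variable W : 'cV[R]_n -> R.
Hypothesis W_pos_unbounded : positive_radially_unbounded W.
Hypothesis W_bound : forall x k, W x <= M k x 0.

Local Notation v0 := (fun _ _ => 0 : 'cV[R]_nv).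
Local Notation sol x0 := (trajectory F w v0 x0).

Let v0_adapted : adapted (noise_filtration w) (v0 : nat -> Omega -> _).
Proof.
move=> k B mB; rewrite noise_filtrationE preimage_cst.
by case: ifP => _; [exact: measurableT|exact: measurable0].
Qed.

Let V_meas k : measurable_fun [set: borelV R n] (V k).
Proof. by case: V_posdef => Vc _ _; exact: continuous_borel_measurable. Qed.

Lemma sol_enorm_measurable x0 k :
  measurable_fun [set: Omega] (fun om => enorm (sol x0 k om)).
Proof.
apply: (@noise_type_measurable_fun _ _ _ _ _ w_meas k).
apply: measurableT_comp (continuous_borel_measurable (@continuous_enorm R n)) _.
exact: trajectory_measurable.
Qed.

(** Since [mu] is strictly increasing, [enorm] exceeding [eps] forces [V k] above [mu eps], an event
    controlled by [V_maximal_inequality]. *)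
Lemma stable_in_probability (eps : R) : 0 < eps ->
  P [set om | (eps%:E <
      ereal_sup (range (fun k => (enorm (sol x0 k om))%:E)))%E]
    @[x0 --> (0 : 'cV[R]_n)^'] --> 0%E.
Proof.
move=> eps0; have [Vc V0 [mu [_ mu_homo _ mu_gt0 muV]]] := V_posdef.
have mueps0 : 0 < mu eps by exact: mu_gt0.
(* A supremum is strictly above [eps] exactly when some term is, so the event is a countable
   union. *)
have supE x0 : [set om | (eps%:E <
      ereal_sup (range (fun k => (enorm (sol x0 k om))%:E)))%E] =
    \bigcup_k [set om | eps < enorm (sol x0 k om)].
  apply/seteqP; split=> [om /= /ereal_sup_gt[_ [k _ <-]]|om [k _ /= ek]].
    by rewrite lte_fin => ek; exists k.
  apply: (@lt_le_trans _ _ (enorm (sol x0 k om))%:E); first by rewrite lte_fin.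
  by apply: ereal_sup_ubound; exists k.
have mE x0 k : measurable [set om | eps < enorm (sol x0 k om)].
  rewrite -[X in measurable X]setTI.
  by apply: measurable_fun_ltr => //; exact: sol_enorm_measurable.
have mV x0 k : measurable [set om | mu eps < V k (sol x0 k om)].
  rewrite -[X in measurable X]setTI; apply: measurable_fun_ltr => //.
  apply: (@noise_type_measurable_fun _ _ _ _ _ w_meas k).
  exact: V_trajectory_measurable.
apply: (@squeeze_cvge _ _ _ _ (cst 0%E) _ (fun x0 => (V 0%N x0 / mu eps)%:E)).
- apply: nearW => x0 /=; rewrite measure_ge0/= supE.
  apply: (@le_trans _ _ (P (\bigcup_k [set om | mu eps < V k (sol x0 k om)]))).
    apply: le_measure; rewrite ?inE; [exact: bigcup_measurable..|].
    move=> om [k _ /= ek]; exists k => //=.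
    apply: lt_le_trans (muV k _).
    by apply: mu_homo => //; rewrite in_itv/= andbT ?enorm_ge0// ltW.
  rewrite EFinM lee_pdivlMr// muleC.
  exact: (V_maximal_inequality w_meas w_indep F_meas V_ge0 M_ge0 S_ge0 V_meas
    M_meas S_meas dissipation x0 v0_adapted (fun _ _ => S0) (ltW mueps0)).
- exact: cvg_cst.
- apply: cvg_EFin; first exact: nearW.
  rewrite -[X in _ --> X](mul0r (mu eps)^-1); apply: cvgMr_tmp.
  (* The upper bound vanishes by continuity of [V 0] at 0, restricted to punctured
     neighbourhoods. *)
  rewrite -(V0 0%N); apply: cvg_trans (Vc 0%N 0); apply: cvg_app.
  exact: cvg_within.
Qed.

Lemma converges_almost_surely (P_complete : measure_is_complete P) x0 :
  P [set om | sol x0 k om @[k --> \oo] --> (0 : 'cV[R]_n)] = 1%E.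
Proof.
pose f om := (\sum_(0 <= k <oo) (M k (sol x0 k om) 0)%:E)%E.
have mM k : measurable_fun [set: Omega] (fun om => (M k (sol x0 k om) 0)%:E).
  apply/measurable_EFinP.
  exact: (M_trajectory_measurable w_meas F_meas M_meas (v := v0)).
have f0 om : (0 <= f om)%E by apply: nneseries_ge0 => k _ _; rewrite lee_fin.
have mf : measurable_fun [set: Omega] f.
  apply: ge0_emeasurable_sum => [k om _ _|k _]; last exact: mM.
  by rewrite lee_fin.
have f_int : P.-integrable setT f.
  apply/integrableP; split=> //; under eq_integral do rewrite gee0_abs//.
  apply: (@le_lt_trans _ _ (V 0%N x0)%:E); last exact: ltry.
  have := dissipation_series w_meas w_indep F_meas V_ge0 M_ge0 S_ge0 V_meas
    M_meas S_meas dissipation x0 v0_adapted.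
  rewrite [X in (_ <= _ + X)%E](_ : _ = 0%E) ?adde0//.
  by apply: integral0_eq => om _; apply: eseries0 => k _ _; rewrite S0.
set Q := [set om | _].
have : {ae P, forall om, Q om}.
  (* An integrable series is finite almost surely, and a finite series of nonnegative terms has
     tails tending to 0. *)
  apply: filterS (integrable_ae measurableT f_int) => om /(_ I) fom.
  have flty : (f om < +oo)%E by rewrite ltey_eq fom.
  have M0 k : (0 <= (M k (sol x0 k om) 0)%:E)%E by rewrite lee_fin.
  have tail0 := nneseries_tail_cvg flty (fun k _ => M0 k).
  rewrite /Q/=; apply/cvgr0Pnorm_le => e e0.
  have [a a0 Wa] := positive_radially_unbounded_lb W_pos_unbounded e0.
  have a_nbhs : nbhs (0%E : \bar R) [set y | (y < a%:E)%E].
    apply: open_nbhs_nbhs; split; first exact: open_ereal_lt_ereal.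
    by rewrite /= lte_fin.
  have tl : \forall N \near \oo,
    (\sum_(N <= k <oo) (M k (sol x0 k om) 0)%:E < a%:E)%E := tail0 _ a_nbhs.
  apply: filterS tl => N /= tailN.
  (* Otherwise [a] would bound [W] from below at time [N], while [W] is at most the first term of a
     tail smaller than [a]. *)
  apply: le_trans (ler_norm_enorm _) _; rewrite leNgt; apply/negP => /ltW/Wa.
  apply/negP; rewrite -ltNge (le_lt_trans (W_bound _ N))// -lte_fin.
  apply: le_lt_trans tailN.
  have := @nneseries_lim_ge R _ xpredT N N.+1 (fun k _ _ => M0 k).
  by rewrite big_nat1.
move=> NQ.
(* The complement of [Q] is so far only contained in a null set; completeness makes it
   measurable. *)
have mNQ : measurable (~` Q) by exact: P_complete.
have PNQ : P (~` Q) = 0%E by apply/negligibleP.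
by rewrite -[Q]setCK probability_setC// PNQ sube0.
Qed.

End InternalStability.

(** * Measurability of the augmented system *)

Section AugmentedMeasurability.
Variables (R : realType) (nx nh nw nv ny nz : nat).
Variables (f : nat -> 'cV[R]_nx -> 'cV[R]_nw -> 'cV[R]_nv -> 'cV[R]_nx)
  (g : nat -> 'cV[R]_nx -> 'cV[R]_nv -> 'cV[R]_ny)
  (m : nat -> 'cV[R]_nx -> 'cV[R]_nv -> 'cV[R]_nz)
  (fh : nat -> 'cV[R]_nh -> 'cV[R]_nh) (gh : nat -> 'cV[R]_ny -> 'cV[R]_nh)
  (mh : nat -> 'cV[R]_nh -> 'cV[R]_nz).
Hypothesis f_cont : forall k, continuous
  (fun p : 'cV[R]_nx * 'cV[R]_nw * 'cV[R]_nv => f k p.1.1 p.1.2 p.2).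
Hypothesis g_cont : forall k, continuous
  (fun p : 'cV[R]_nx * 'cV[R]_nv => g k p.1 p.2).
Hypothesis m_cont : forall k, continuous
  (fun p : 'cV[R]_nx * 'cV[R]_nv => m k p.1 p.2).
Hypothesis fh_meas : forall k,
  measurable_fun [set: borelV R nh] (fh k : borelV R nh -> borelV R nh).
Hypothesis gh_meas : forall k,
  measurable_fun [set: borelV R ny] (gh k : borelV R ny -> borelV R nh).
Hypothesis mh_meas : forall k,
  measurable_fun [set: borelV R nh] (mh k : borelV R nh -> borelV R nz).
Context d (T : measurableType d).
Variables (eta : T -> 'cV[R]_(nx + nh)) (w : T -> 'cV[R]_nw)
  (v : T -> 'cV[R]_nv).
Hypotheses (beta : borel_fun eta) (bw : borel_fun w) (bv : borel_fun v).

Let cb n : countably_based 'cV[R]_n. Proof. exact: countably_based_mx. Qed.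

Let bx : borel_fun (fun t => usubmx (eta t)).
Proof. exact: borel_fun_comp (@continuous_usubmx _ _ _ _) beta. Qed.

Let bxh : borel_fun (fun t => dsubmx (eta t)).
Proof. exact: borel_fun_comp (@continuous_dsubmx _ _ _ _) beta. Qed.

Let bcomp a b (h : 'cV[R]_a -> 'cV[R]_b) (y : T -> 'cV[R]_a) :
  measurable_fun [set: borelV R a] (h : borelV R a -> borelV R b) ->
  borel_fun y -> borel_fun (h \o y).
Proof.
move=> mh' /borel_funP my; apply/borel_funP; exact: measurableT_comp mh' my.
Qed.

Lemma borel_aug_f k :
  borel_fun (fun t => aug_f f g fh gh k (eta t) (w t) (v t)).
Proof.
have bf := borel_fun_comp (@f_cont k)
  (borel_fun_pair (countably_based_prod (cb _) (cb _)) (cb _)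
    (borel_fun_pair (cb _) (cb _) bx bw) bv).
have bg := borel_fun_comp (@g_cont k) (borel_fun_pair (cb _) (cb _) bx bv).
have bh := borel_fun_comp (@add_continuous _)
  (borel_fun_pair (cb _) (cb _) (bcomp (@fh_meas k) bxh)
    (bcomp (@gh_meas k) bg)).
exact: borel_fun_comp (@continuous_col_mx _ _ _ _)
  (borel_fun_pair (cb _) (cb _) bf bh).
Qed.

Lemma borel_aug_m k : borel_fun (fun t => aug_m m mh k (eta t) (v t)).
Proof.
have bm := borel_fun_comp (@m_cont k) (borel_fun_pair (cb _) (cb _) bx bv).
have bN := borel_fun_comp (@opp_continuous _) (bcomp (@mh_meas k) bxh).
exact: borel_fun_comp (@add_continuous _)
  (borel_fun_pair (cb _) (cb _) bm bN).
Qed.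

End AugmentedMeasurability.

(** * Stability of the augmented system *)

Theorem theorem1 (R : realType) (d : measure_display) (Omega : measurableType d)
  (P : probability Omega R) (P_complete : measure_is_complete P)
  (nx nh nw nv ny nz : nat)
  (w : nat -> Omega -> 'cV[R]_nw)
  (w_meas : forall k, measurable_fun [set: Omega] (w k : Omega -> borelV R nw))
  (w_indep : independent_seq P w)
  (f : nat -> 'cV[R]_nx -> 'cV[R]_nw -> 'cV[R]_nv -> 'cV[R]_nx)
  (g : nat -> 'cV[R]_nx -> 'cV[R]_nv -> 'cV[R]_ny)
  (m : nat -> 'cV[R]_nx -> 'cV[R]_nv -> 'cV[R]_nz)
  (f_cont : forall k, continuous
     (fun p : 'cV[R]_nx * 'cV[R]_nw * 'cV[R]_nv => f k p.1.1 p.1.2 p.2))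
  (g_cont : forall k, continuous
     (fun p : 'cV[R]_nx * 'cV[R]_nv => g k p.1 p.2))
  (m_cont : forall k, continuous
     (fun p : 'cV[R]_nx * 'cV[R]_nv => m k p.1 p.2))
  (f0 : forall k, f k 0 0 0 = 0)
  (g0 : forall k, g k 0 0 = 0)
  (m0 : forall k, m k 0 0 = 0)
  (fh : nat -> 'cV[R]_nh -> 'cV[R]_nh)
  (gh : nat -> 'cV[R]_ny -> 'cV[R]_nh)
  (mh : nat -> 'cV[R]_nh -> 'cV[R]_nz)
  (fh_meas : forall k,
     measurable_fun [set: borelV R nh] (fh k : borelV R nh -> borelV R nh))
  (gh_meas : forall k,
     measurable_fun [set: borelV R ny] (gh k : borelV R ny -> borelV R nh))
  (mh_meas : forall k,
     measurable_fun [set: borelV R nh] (mh k : borelV R nh -> borelV R nz))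
  (fh0 : forall k, fh k 0 = 0)
  (gh0 : forall k, gh k 0 = 0)
  (mh0 : forall k, mh k 0 = 0)
  (gamma : R) (gamma_gt0 : 0 < gamma)
  (V : nat -> 'cV[R]_(nx + nh) -> R)
  (V_ge0 : forall k eta, 0 <= V k eta)
  (V_posdef : positive_definite_seq V)
  (V_unbounded : radially_unbounded_seq V)
  (W : 'cV[R]_(nx + nh) -> R)
  (W_ge0 : forall eta, 0 <= W eta)
  (W_pos_unbounded : positive_radially_unbounded W)
  (V_dissipation : forall (eta : 'cV[R]_(nx + nh)) (v : 'cV[R]_nv) (k : nat),
     ('E_P[fun om => V k.+1 (aug_f f g fh gh k eta (w k om) v)]
      - (V k eta)%:E + (enorm (aug_m m mh k eta v) ^+ 2)%:E
      - (gamma ^+ 2 * enorm v ^+ 2)%:E <= 0)%E)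
  (W_bound : forall (eta : 'cV[R]_(nx + nh)) (k : nat),
     W eta <= enorm (aug_m m mh k eta 0) ^+ 2) :
  Hinfty_filter P (aug_f f g fh gh) (aug_m m mh) w gamma.

Proof.
have cbv n : borel_fun (id : borelV R n -> 'cV[R]_n).
  by apply/borel_funP; exact: measurable_id.
have F_meas k : measurable_fun
    [set: (borelV R (nx + nh) * borelV R nw * borelV R nv)%type]
    (fun p => aug_f f g fh gh k p.1.1 p.1.2 p.2 : borelV R (nx + nh)).
  apply/borel_funP.
  (* Joint measurability is the case where the inputs are the coordinate projections of the product
     of the Borel spaces. *)
  apply: (borel_aug_f f_cont g_cont fh_meas gh_meas
    (T := (borelV R (nx + nh) * borelV R nw * borelV R nv)%type)
    (eta := fun p => p.1.1) (w := fun p => p.1.2) (v := snd)).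
  - apply/borel_funP; exact: measurableT_comp measurable_fst measurable_fst.
  - apply/borel_funP; exact: measurableT_comp measurable_snd measurable_fst.
  - apply/borel_funP; exact: measurable_snd.
have enorm2_meas n : measurable_fun [set: borelV R n] (fun x => enorm x ^+ 2).
  apply: measurable_funX; apply: continuous_borel_measurable.
  exact: continuous_enorm.
pose M k eta v := enorm (aug_m m mh k eta v) ^+ 2.
pose S (v : 'cV[R]_nv) := gamma ^+ 2 * enorm v ^+ 2.
have M_meas k : measurable_fun
    [set: (borelV R (nx + nh) * borelV R nv)%type] (fun p => M k p.1 p.2).
  have bm : borel_fun (fun p : borelV R (nx + nh) * borelV R nv =>
      aug_m m mh k p.1 p.2).
    apply: (borel_aug_m m_cont mh_meas
      (T := (borelV R (nx + nh) * borelV R nv)%type) (eta := fst) (v := snd)).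
    - apply/borel_funP; exact: measurable_fst.
    - apply/borel_funP; exact: measurable_snd.
  by move/borel_funP : bm => bm; exact: measurableT_comp (enorm2_meas nz) bm.
have S_meas : measurable_fun [set: borelV R nv] S.
  exact: measurable_funM.
have M_ge0 k eta v : 0 <= M k eta v by exact: sqr_ge0.
have S_ge0 v : 0 <= S v by rewrite mulr_ge0// sqr_ge0.
have S0 : S 0 = 0 by rewrite /S enorm0 expr0n mulr0.
have dissipation k eta v :
    (\int[P]_om (V k.+1 (aug_f f g fh gh k eta (w k om) v))%:E + (M k eta v)%:E
     <= (V k eta)%:E + (S v)%:E)%E.
  have := V_dissipation eta v k; rewrite unlock.
  set I := (\int[P]_om _)%E.
  (* Only the finite terms in [V k eta] and [gamma] cross the inequality. *)
  by rewrite lee_subel_addr// add0e addeAC lee_subel_addr// [leRHS]addeC.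
have V_meas k : measurable_fun [set: borelV R (nx + nh)] (V k).
  by case: V_posdef => Vc _ _; exact: continuous_borel_measurable.
split; first split.
- exact: (stable_in_probability w_meas w_indep F_meas V_ge0 M_ge0 S_ge0
    V_posdef M_meas S_meas S0 dissipation).
- exact: (converges_almost_surely w_meas w_indep F_meas V_ge0 M_ge0 S_ge0
    V_posdef M_meas S_meas S0 dissipation W_pos_unbounded W_bound P_complete).
- move=> v [v_adapted _] _.
  have := dissipation_series w_meas w_indep F_meas V_ge0 M_ge0 S_ge0 V_meas
    M_meas S_meas dissipation 0 v_adapted.
  (* The zero initial state removes the storage term; it remains to pull [gamma ^+ 2] out of the
     integral and the series. *)
  have [_ V0 _] := V_posdef; rewrite V0 add0e => /le_trans; apply.
  rewrite /l2normsq -ge0_integralZl//; last 3 first.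
  + apply: ge0_emeasurable_sum => [k om _ _|k _].
      by rewrite lee_fin sqr_ge0.
    apply/measurable_EFinP.
    apply: (@noise_type_measurable_fun _ _ _ _ _ w_meas k).
    have vk_meas : measurable_fun [set: noise_type w k]
      (v k : noise_type w k -> borelV R nv) by exact: adapted_measurable.
    exact: measurableT_comp (enorm2_meas nv) vk_meas.
  + by move=> om _; apply: nneseries_ge0 => k _ _; rewrite lee_fin sqr_ge0.
  + by rewrite lee_fin sqr_ge0.
  rewrite le_eqVlt; apply/orP; left; apply/eqP; apply: eq_integral => om _.
  rewrite -nneseriesZl => [|k _]; last by rewrite lee_fin sqr_ge0.
  by under [RHS]eq_eseriesr do rewrite -EFinM.
Qed.
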